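(* Let $n\ge1$ and let $u,v,w\ge 0$ be integers with $u+v+w=n$. For any $P\in H_{u,v,w}$ and any $Q\in Hyp_n^-$ one has $P\ast Q\in H_{u,v,w}$. In particular, $Hyp_n^-$ is a semigroup with respect to the Schur–Szegő composition $\ast$.
   Context: The Schur–Szegő composition (with respect to $n$) of $P(x)=\sum_{i=0}^n\binom{n}{i}a_ix^i$ and $Q(x)=\sum_{i=0}^n\binom{n}{i}b_ix^i$ is $P\ast Q(x)=\sum_{i=0}^n\binom{n}{i}a_ib_ix^i$. $Hyp_n$ is the set of real polynomials of degree $n$ all of whose roots are real. $Hyp_n^-\subset Hyp_n$ is the subset of polynomials all of whose roots are negative. $H_{u,v,w}\subset Hyp_n$ is the set of polynomials having (counted with multiplicity) $u$ negative roots, $w$ positive roots, and $0$ as a root of multiplicity $v$. *)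

(* Defs.v *)
From mathcomp Require Import all_boot all_order all_algebra.
From mathcomp Require Import reals.
From mathcomp.real_closed Require Import polyrcf complex.

Set Implicit Arguments.
Unset Strict Implicit.
Unset Printing Implicit Defensive.

Import Order.TTheory GRing.Theory Num.Theory.

Local Open Scope ring_scope.
Local Open Scope complex_scope.

(* The a_i of P = \sum_(i <= n) 'C(n, i) a_i 'X^i, for size P <= n.+1 and
   i <= n. *)
Definition bincoef (R : realType) (n : nat) (P : {poly R}) (i : nat) : R :=
  P`_i / 'C(n, i)%:R.

Definition schur_szego (R : realType) (n : nat) (P Q : {poly R}) : {poly R} :=
  \poly_(i < n.+1) ('C(n, i)%:R * bincoef n P i * bincoef n Q i).

(* "All roots" means all complex roots of P. *)
Definition Hyp (R : realType) (n : nat) (P : {poly R}) : Prop :=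
  size P = n.+1 /\
  forall z : R[i], root (map_poly (real_complex R) P) z -> complex.Im z = 0.

Definition HypNeg (R : realType) (n : nat) (P : {poly R}) : Prop :=
  Hyp n P /\ forall x : R, root P x -> x < 0.

(* rootsR lists each real root once, so multiplicities are added up by mup. *)
Definition num_neg_roots (R : realType) (P : {poly R}) : nat :=
  (\sum_(x <- rootsR P | (x < 0)%R) mup x P)%N.

Definition num_pos_roots (R : realType) (P : {poly R}) : nat :=
  (\sum_(x <- rootsR P | (0 < x)%R) mup x P)%N.

Definition Hsign (R : realType) (n u v w : nat) (P : {poly R}) : Prop :=
  [/\ Hyp n P, num_neg_roots P = u, mup 0 P = v & num_pos_roots P = w].

Definition semigroup_on (T : Type) (S : T -> Prop) (op : T -> T -> T) : Prop :=
  (forall x y, S x -> S y -> S (op x y)) /\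
  (forall x y z, S x -> S y -> S z -> op x (op y z) = op (op x y) z).

(* Main.v *)
(* Write Q = c \prod_j (X - r_j) with all r_j < 0.  Up to a nonzero constant,
   (P * Q)(z) is the polarization of P (its symmetric multiaffine form in n
   variables) evaluated at the points - z / r_j, all of which lie in the open
   upper half-plane H when z does.  By Laguerre's theorem the polar derivative
   P - (X - w) P' / n, for w in H, has no zero in H if P has none; removing the
   r_j one at a time shows that P * Q has no zero in H, hence, being real, only
   real zeros.  The coefficients of Q are nonzero and all of the same sign, so
   P and P * Q have the same sign variations, and for a polynomial with only
   real zeros Descartes' rule, applied to f(x) and f(-x), is an equality, so
   the sign variations determine the numbers of positive, zero and negative
   roots. *)
Require Import Defs.
From mathcomp Require Import all_boot all_order all_algebra.
From mathcomp Require Import reals.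
From mathcomp Require Import ring lra zify.
From mathcomp.real_closed Require Import polyrcf complex.

Set Implicit Arguments.
Unset Strict Implicit.
Unset Printing Implicit Defensive.

Import Order.TTheory GRing.Theory Num.Theory.

Local Open Scope ring_scope.

(** * Polar derivatives and zeros in the upper half-plane *)

Section Stability.
Variable C : numClosedFieldType.
Implicit Types (P Q : {poly C}) (s : seq C) (z w a : C) (n : nat).

Definition stable P := forall z, 0 < 'Im z -> P.[z] != 0.

Definition polar n w P := P - n%:R^-1 *: (('X - w%:P) * P^`()).

(** The squared moduli differ only in the terms [('Im z + 'Im a)^2] and [('Im z - 'Im a)^2]. For [z]
    in the upper half-plane, the sign of ['Im a] thus decides which of [z] and its mirror image is
    nearer to [a]. *)
Lemma norm_conj_sub z a :
  `|z^* - a| ^+ 2 = `|z - a| ^+ 2 + 4 * ('Im z * 'Im a).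
Proof. by rewrite !normC2_Re_Im !raddfB /= Re_conj Im_conj; ring. Qed.

Lemma norm_conj_sub_le z a : 0 < 'Im z -> 'Im a <= 0 -> `|z^* - a| <= `|z - a|.
Proof.
move=> z0 a0; rewrite -(@ler_pXn2r _ 2) ?nnegrE // norm_conj_sub gerDl.
by rewrite pmulr_rle0 // pmulr_rle0.
Qed.

Lemma norm_conj_sub_lt z a : 0 < 'Im z -> 0 < 'Im a -> `|z - a| < `|z^* - a|.
Proof.
move=> z0 a0; rewrite -(@ltr_pXn2r _ 2) ?nnegrE // norm_conj_sub ltrDl.
by rewrite !mulr_gt0.
Qed.

Lemma deriv_prod_XsubC s z : all (fun a => z != a) s ->
  (\prod_(a <- s) ('X - a%:P))^`().[z] =
  (\prod_(a <- s) ('X - a%:P)).[z] * \sum_(a <- s) (z - a)^-1.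
Proof.
elim: s => [|a s IH] /=; first by rewrite !big_nil derivC horner0 mulr0.
case/andP=> za /IH {}IH; rewrite !big_cons derivM derivXsubC mul1r.
rewrite hornerD !hornerM IH hornerXsubC.
by field; rewrite subr_eq0.
Qed.

(* The number \sum_a (z^* - a) / (z - a) over the zeros a of P has modulus at
   most the number of zeros, while a zero z of the polar derivative forces the
   same sum, completed by 1s to n terms, to be n (z^* - w) / (z - w), of modulus
   larger than n. *)
Lemma polar_stable n w P : (0 < n)%N -> (size P <= n.+1)%N -> 0 < 'Im w ->
  stable P -> stable (polar n w P).
Proof.
move=> n0 sP w0 stP z z0; have Pz := stP z z0.
have [s Ps] := closed_field_poly_normal P.
have P0 : P != 0 by apply: contraNneq Pz => ->; rewrite horner0.
have ss : (size s <= n)%N.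
  by move: sP; rewrite Ps size_scale ?lead_coef_eq0 // size_prod_XsubC.
have rs a : a \in s -> 'Im a <= 0.
  move=> sa; rewrite real_leNgt ?rpred0 //; apply/negP => /stP/negP; apply.
  by rewrite -rootE Ps rootZ ?lead_coef_eq0 // root_prod_XsubC.
have zs a : a \in s -> z - a != 0.
  move=> sa; rewrite subr_eq0; apply: contraTneq z0 => ->.
  by rewrite -real_leNgt ?rpred0 // rs.
pose S := \sum_(a <- s) (z - a)^-1.
have dP : P^`().[z] = P.[z] * S.
  rewrite [in LHS]Ps [in RHS]Ps derivZ !hornerZ deriv_prod_XsubC ?mulrA //.
  by apply/allP => a /zs; rewrite subr_eq0.
apply/negP; rewrite /polar hornerD hornerN hornerZ hornerM hornerXsubC dP.
have nC : n%:R != 0 :> C by rewrite pnatr_eq0 -lt0n.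
have -> : P.[z] - n%:R^-1 * ((z - w) * (P.[z] * S)) =
          P.[z] * (n%:R^-1 * (n%:R - (z - w) * S)) by field.
rewrite !mulf_eq0 (negPf Pz) invr_eq0 (negPf nC) /= => /eqP/subr0_eq nS.
have zw : z - w != 0.
  by apply: contraNneq nC => zw; rewrite nS zw mul0r.
have E : n%:R * ((z^* - w) / (z - w)) =
    \sum_(a <- s) ((z^* - a) / (z - a)) + (n - size s)%:R.
  have -> : \sum_(a <- s) ((z^* - a) / (z - a)) = (size s)%:R - (z - z^*) * S.
    rewrite /S mulr_sumr -sum1_size natr_sum -sumrB !big_seq.
    by apply: eq_bigr => a /zs za; field.
  rewrite natrB //; have -> : S = n%:R / (z - w).
    by rewrite nS mulrAC divff ?mul1r.
  by field.
have : n%:R * (`|z^* - w| / `|z - w|) <= n%:R.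
  rewrite -[X in X * _]ger0_norm // -normf_div -normrM E.
  rewrite (le_trans (ler_normD _ _)) // normr_nat natrB // addrCA gerDl.
  rewrite subr_le0.
  rewrite (le_trans (ler_norm_sum _ _ _)) // -sum1_size natr_sum !big_seq.
  apply: ler_sum => a sa; rewrite normf_div ler_pdivrMr ?normr_gt0 ?zs // mul1r.
  by rewrite norm_conj_sub_le ?rs.
rewrite ger_pMr ?ltr0n // ler_pdivrMr ?normr_gt0 // mul1r.
by rewrite lt_geF // norm_conj_sub_lt.
Qed.

Lemma coef_polar n w P i : (polar n w P)`_i =
  P`_i - n%:R^-1 * (P`_i *+ i - w * (P`_i.+1 *+ i.+1)).
Proof.
rewrite /polar coefB coefZ mulrBl coefB coefXM coefCM !coef_deriv.
by case: i => [|i] //=; rewrite !mulr0n.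
Qed.

(** In degree [n.+1] the terms of [P] and [X P' / n.+1] cancel, so the degree bound drops with each
    removed root. *)
Lemma size_polar n w P :
  (size P <= n.+2)%N -> (size (polar n.+1 w P) <= n.+1)%N.
Proof.
move=> sP; apply/leq_sizeP => i; rewrite leq_eqVlt => /predU1P[<-|ni].
  rewrite coef_polar [P`_n.+2]nth_default // mul0rn mulr0 subr0.
  by rewrite -[P`_n.+1 *+ _]mulr_natl mulKf ?subrr // pnatr_eq0.
rewrite coef_polar ![P`__]nth_default ?(leq_trans sP) ?leqW //.
by rewrite !mul0rn mulr0 subr0 mulr0 subr0.
Qed.

Lemma Im_divN_gt0 a z : a < 0 -> 0 < 'Im z -> 0 < 'Im (- z / a).
Proof.
move=> a0 z0; rewrite mulNr -mulrN ImM.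
have ar : - a^-1 \is Num.real by rewrite rpredN rpredV ltr0_real.
have /Creal_ImP-> := ar.
by rewrite (Creal_ReP _ ar) mulr0 add0r mulr_gt0 // oppr_gt0 invr_lt0.
Qed.

(** With [c_i = P_i / 'C(n.+1, i)], the polar derivative has normalized coefficients
    [c_i + w c_{i+1}]: the factors [(n.+1 - i) / n.+1] and [i.+1 / n.+1] are ratios of binomials. *)
Lemma polar_bin n i (p q w : C) : (i <= n)%N ->
  (p - n.+1%:R^-1 * (p *+ i - w * (q *+ i.+1))) / 'C(n, i)%:R =
  p / 'C(n.+1, i)%:R + w * q / 'C(n.+1, i.+1)%:R.
Proof.
move=> le_in.
have E1 : 'C(n.+1, i.+1)%:R = n.+1%:R / i.+1%:R * 'C(n, i)%:R :> C.
  apply: (@mulfI _ i.+1%:R); first by rewrite pnatr_eq0.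
  by rewrite mulrA mulrCA divff ?pnatr_eq0 // mulr1 -!natrM mul_bin_diag.
have E2 : 'C(n.+1, i)%:R = n.+1%:R / (n.+1 - i)%:R * 'C(n, i)%:R :> C.
  have H : (n.+1 - i)%:R != 0 :> C by rewrite pnatr_eq0 subn_eq0 -ltnNge ltnS.
  apply: (@mulfI _ (n.+1 - i)%:R) => //.
  by rewrite mulrA mulrCA divff // mulr1 -!natrM -mul_bin_down.
rewrite E1 E2 -[p *+ i]mulr_natl -[q *+ _]mulr_natl natrB 1?leqW //.
have Cn : 'C(n, i)%:R != 0 :> C by rewrite pnatr_eq0 -lt0n bin_gt0.
have H : (n.+1%:R - i%:R) != 0 :> C.
  by rewrite -natrB 1?leqW // pnatr_eq0 subn_eq0 -ltnNge ltnS.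
have H1 : n.+1%:R != 0 :> C by rewrite pnatr_eq0.
have H2 : i.+1%:R != 0 :> C by rewrite pnatr_eq0.
by field; rewrite -!natr1 !(addrC _ 1) in H H1 H2; rewrite Cn H H1 H2.
Qed.

(** For [w = - z / a], [- a (c_i + w c_{i+1})] equals [z c_{i+1} - a c_i], which is what the factor
    [X - a] contributes. As [w] depends on [z], the identity is stated at a point. *)
Lemma schur_szego_step n P Q a z : a != 0 -> (size Q <= n.+1)%N ->
  \sum_(i < n.+2) P`_i * (('X - a%:P) * Q)`_i / 'C(n.+1, i)%:R * z ^+ i =
  - a * \sum_(i < n.+1)
    (polar n.+1 (- z / a) P)`_i * Q`_i / 'C(n, i)%:R * z ^+ i.
Proof.
move=> a0 sQ.
pose F i := P`_i * Q`_i / 'C(n.+1, i)%:R * z ^+ i.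
pose G i := P`_i.+1 * Q`_i / 'C(n.+1, i.+1)%:R * z ^+ i.+1.
have -> :
    \sum_(i < n.+2) P`_i * (('X - a%:P) * Q)`_i / 'C(n.+1, i)%:R * z ^+ i =
    \sum_(i < n.+1) G i - a * \sum_(i < n.+2) F i.
  rewrite mulr_sumr big_ord_recl (big_ord_recl n.+1 (fun i => a * F i)) /=.
  rewrite opprD addrCA -sumrB.
  congr (_ + _); first by rewrite mulrBl coefB coefXM coefCM /= sub0r /F; ring.
  apply: eq_bigr => i _; rewrite /bump /= add1n mulrBl coefB coefXM coefCM /=.
  by rewrite /F /G; ring.
rewrite [\sum_(i < n.+2) _]big_ord_recr /= {2}/F [Q`_n.+1]nth_default //.
rewrite mulr0 !mul0r addr0 !mulr_sumr -sumrB; apply: eq_bigr => i _.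
rewrite coef_polar [_ * Q`_i / _]mulrAC polar_bin -1?ltnS // /F /G exprS.
by move: ('C(n.+1, i)%:R^-1) ('C(n.+1, i.+1)%:R^-1) => c d; field.
Qed.
(** Induction on the roots with [P] varying: each root turns [P] into a polar derivative, still
    stable, until a nonzero constant remains. *)
Lemma schur_szego_stable s n P z : size s = n -> (size P <= n.+1)%N ->
  stable P -> all (fun a => a < 0) s -> 0 < 'Im z ->
  \sum_(i < n.+1)
    P`_i * (\prod_(a <- s) ('X - a%:P))`_i / 'C(n, i)%:R * z ^+ i != 0.
Proof.
elim: s n P => [|a s IH] n P /=.
  move=> <- sP stP _ z0; rewrite big_ord1 big_nil coef1 bin0 invr1 !mulr1.
  by have := stP _ z0; rewrite [P in P.[_]]size1_polyC // hornerC.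
case: n => // n [sn] sP stP /andP[a0 s0] z0.
rewrite big_cons schur_szego_step; [|exact: ltr0_neq0|]; last first.
  by rewrite size_prod_XsubC sn.
have w0 := Im_divN_gt0 a0 z0.
apply: mulf_neq0; first by rewrite oppr_eq0 ltr0_neq0.
apply: IH => //; [exact: size_polar | exact: polar_stable].
Qed.
End Stability.

(** * Sign variations of coefficient sequences *)

Section Descartes.
Variable R : realFieldType.
Implicit Types (p : R) (P Q : {poly R}) (f : nat -> R) (d e a : bool) (n : nat).

(* Sign variations of f (n-1), ..., f 0 preceded by an entry of sign e, where
   [true] means positive and zeros are skipped; with d = true, those of
   (-1)^i f i, e being relative to the sign of (-1)^n. *)
Fixpoint variation d e f n : nat :=
  if n is m.+1 then
    if f m == 0 then variation d (e (+) d) f m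
    else (((e (+) d) != (0 < f m)%R) + variation d (0 < f m)%R f m)%N
  else 0.

Lemma variationS d e f n : variation d e f n.+1 =
  if f n == 0 then variation d (e (+) d) f n
  else (((e (+) d) != (0 < f n)%R) + variation d (0 < f n)%R f n)%N.
Proof. by []. Qed.

(** A variation compares two signs, so reversing all of them, [e] included, changes nothing. *)
Lemma variation_sign d e f g c n :
  (forall i, (i < n)%N -> (f i == 0) = (g i == 0)) ->
  (forall i, (i < n)%N -> g i != 0 -> (0 < f i) = (0 < g i) (+) c) ->
  variation d (e (+) c) f n = variation d e g n.
Proof.
elim: n e => //= n IH e H0 H1; rewrite H0 //.
have IHe e' : variation d (e' (+) c) f n = variation d e' g n.
  by apply: IH => i ni; [apply: H0 | apply: H1]; rewrite ltnW.
have [g0|g0] := ifPn; first by rewrite addbAC IHe.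
by rewrite H1 // IHe; case: e; case: (d); case: (c); case: (0 < _).
Qed.

Lemma variation0 d e f n : (forall i, (i < n)%N -> f i = 0) ->
  variation d e f n = 0%N.
Proof.
elim: n e => //= n IH e f0; rewrite f0 // eqxx IH // => i ni.
exact/f0/ltnW.
Qed.

(** At a nonzero entry exactly one of the two counts grows if [e = e']; otherwise both or neither
    do, whence the correction [e != e'], which a zero entry toggles. *)
Lemma variation_add_le e e' f v k : (forall i, (i < v)%N -> f i = 0) ->
  (variation false e f (k + v) + variation true e' f (k + v)
    <= k + (e != e'))%N.
Proof.
move=> f0; elim: k e e' => [|k IH] e e'; first by rewrite !add0n !variation0.
rewrite addSn /=; case: eqP => _.
  by have := IH (e (+) false) (e' (+) true); case: e; case: e' => /=; lia.
have := IH (0 < f (k + v)%N) (0 < f (k + v)%N).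
by rewrite eqxx; case: e; case: e'; case: (0 < _) => /=; lia.
Qed.

(** The hypothesis says that [b] and [- p * S] do not have opposite signs, so nothing cancels. *)
Lemma sub_mul_sign (p S b : R) : p != 0 -> S != 0 ->
  (b == 0) || ((0 < b) != ((0 < S) (+) (p < 0))) ->
  (b - p * S != 0) && ((0 < b - p * S) == ~~ ((0 < S) (+) (p < 0))).
Proof.
move=> p0 S0 H.
have pS : p * S != 0 by rewrite mulf_neq0.
have E : (0 < S) (+) (p < 0) = (0 < p * S).
  case: (ltgtP p 0) p0 => // p0 _.
    by rewrite nmulr_rgt0 // addbT; case: (ltgtP S 0) S0.
  by rewrite pmulr_rgt0 // addbF.
rewrite {}E in H *; move: (p * S) pS H => t; rewrite subr_eq0 subr_gt0.
by case: (ltgtP t 0) => // t0 _; case: (ltgtP b 0) => //= b0 _;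
  case: (ltgtP t b) => //=; lra.
Qed.

(* e and a are the signs of the last nonzero coefficients of P and of (X - p) P
   read so far, S and b the current and the next coefficient of P: in passing to
   the next coefficient, the variations of (X - p) P exceed those of P by at
   least the change of [e != a]. *)
Lemma variation_step d e a (p S b : R) (V W : bool -> nat) :
  p != 0 -> (p < 0) = d ->
  (forall e a, (if b == 0 then e != a else e == (0 < b)) ->
     (V e + 1 <= W a + (e != a))%N) ->
  (if S == 0 then e != a else e == (0 < S)) ->
  ((if b == 0%R then V (e (+) d)
    else ((e (+) d) != (0 < b)%R) + V (0 < b)%R) + 1
   <= (if (b - p * S == 0)%R then W (a (+) d)
       else ((a (+) d) != (0 < b - p * S)%R) + W (0 < b - p * S)%R)
      + (e != a))%N.
Proof.
move=> p0 pd /(_ (if b == 0 then e (+) d else (0 < b))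
  (if b - p * S == 0 then a (+) d else (0 < b - p * S))).
have [-> | S0] := eqVneq S 0.
  rewrite mulr0 subr0; case: (b == 0).
    by case: e; case: a; case: (d) => //= /(_ isT); lia.
  by rewrite eqxx; case: e; case: a; case: (d); case: (0 < _) => //= /(_ isT);
    lia.
have := sub_mul_sign (b := b) p0 S0; rewrite pd => H H' /eqP E.
rewrite -E in H; clear E; move: H H'.
move: (b - _) => g; case: (b == 0) => /=.
  move=> /(_ isT)/andP[/negPf-> /eqP ->].
  by case: e; case: a; case: (d) => //= /(_ isT); lia.
rewrite eqxx => H /(_ isT); move: H.
by case: (g == 0); case: (0 < g); case: (0 < b); case: e; case: a; case: (d);
  move=> /= H H'; try (by have := H isT); lia.
Qed.

Lemma variation_mulXsubC d p P m e a :
  p != 0 -> (p < 0) = d ->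
  (if P`_m == 0 then e != a else e == (0 < P`_m)) ->
  (variation d e (fun i => P`_i)%R m + 1 <=
   variation d a (fun i => (('X - p%:P) * P)`_i)%R m.+1 + (e != a))%N.
Proof.
move=> p0 pd; elim: m e a => [|m IH] e a.
  (* The product ends with [- p P_0]. If [P_0] is nonzero and [e = a], this makes the extra
     variation; otherwise [e != a] supplies the 1. *)
  rewrite /= mulrBl coefB coefXM coefCM /=.
  case: ifP => [_ ea|/negbT P0 /eqP->]; first by rewrite ea; lia.
  have := sub_mul_sign (b := 0) p0 P0.
  rewrite eqxx => /(_ isT) /andP[/negPf-> /eqP->].
  by rewrite pd; case: (0 < _); case: (d); case: a.
rewrite (variationS d a) (variationS d e).
have -> : (('X - p%:P) * P)`_m.+1 = P`_m - p * P`_m.+1.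
  by rewrite mulrBl coefB coefXM coefCM.
exact: (variation_step (V := fun e => variation d e _ m)
  (W := fun a => variation d a _ m.+1)).
Qed.
End Descartes.

(** * Descartes' rule and its equality case *)

Section SignCounts.
Variable R : rcfType.
Implicit Types (P Q : {poly R}) (s t : seq R) (p x c : R) (d : bool).

Definition poly_variation d P :=
  variation d (0 < lead_coef P) (fun i => P`_i) (size P).-1.

Lemma poly_variation_mulXsubC d p P : P != 0 -> p != 0 -> (p < 0) = d ->
  (poly_variation d P < poly_variation d (('X - p%:P) * P))%N.
Proof.
move=> P0 p0 pd; have lG : lead_coef (('X - p%:P) * P) = lead_coef P.
  by rewrite mulrC lead_coef_Mmonic ?monicXsubC.
have sG : size (('X - p%:P) * P) = (size P).-1.+2.
  rewrite mulrC size_Mmonic ?monicXsubC // size_XsubC addn2 prednK //.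
  by rewrite size_poly_gt0.
rewrite /poly_variation lG sG -addn1.
have := variation_mulXsubC (P := P) (m := (size P).-1)
  (e := 0 < lead_coef P) (a := 0 < lead_coef P) p0 pd.
by rewrite -lead_coefE lead_coef_eq0 (negPf P0) eqxx addn0; apply.
Qed.

(** The factors of the other roots are gathered in a nonzero [Q]; each counted root then adds a
    variation. *)
Lemma count_le_poly_variation d c s : c != 0 ->
  (count (fun x => (x != 0) && ((x < 0) == d))%R s <=
   poly_variation d (c *: \prod_(x <- s) ('X - x%:P))%R)%N.
Proof.
move=> c0; set D := fun x => _.
rewrite -(perm_big _ (introT permPl (perm_filterC D s))) /= big_cat /=.
rewrite scalerAr; set Q : {poly R} := c *: _.
have Q0 : Q != 0 by rewrite scaler_eq0 (negPf c0) monic_neq0 ?monic_prod_XsubC.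
clearbody Q; elim: s => //= x s IH.
case Dx: (D x) => //=; have /andP[x0 /eqP xd] := Dx.
rewrite big_cons -mulrA add1n (leq_ltn_trans IH) // poly_variation_mulXsubC //.
by apply: mulf_neq0 => //; rewrite monic_neq0 ?monic_prod_XsubC.
Qed.

Lemma mup_scale_prod_XsubC c s x : c != 0 ->
  mup x (c *: \prod_(y <- s) ('X - y%:P)) = count_mem x s.
Proof. by move=> c0; rewrite -mul_polyC mupMr ?rootC // mu_prod_XsubC. Qed.

Lemma sum_count_mem (T : eqType) (a : pred T) (r s : seq T) :
  uniq r -> {subset s <= r} ->
  (\sum_(x <- r | a x) count_mem x s)%N = count a s.
Proof.
move=> ur; elim: s => [|y s IH] sr /=; first by rewrite big1.
rewrite big_split /= IH => [|x xs]; last by rewrite sr // inE xs orbT.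
congr addn; rewrite big_mkcond (bigD1_seq y) ?sr ?mem_head //= eqxx.
by rewrite big1 => [|x /negPf xy]; rewrite ?addn0 1?eq_sym ?xy; case: (a _).
Qed.

(** Links the sums of [mup] defining [Hsign] to counts in a list of roots with repetition. *)
Lemma sum_mup_rootsR c s (a : pred R) : c != 0 ->
  let P := c *: \prod_(y <- s) ('X - y%:P) in
  (\sum_(x <- rootsR P | a x) mup x P)%N = count a s.
Proof.
move=> c0 P; have P0 : P != 0.
  by rewrite scaler_eq0 (negPf c0) monic_neq0 ?monic_prod_XsubC.
under eq_bigr do rewrite mup_scale_prod_XsubC //.
apply: sum_count_mem; first exact: uniq_roots.
move=> x xs; have /roots_on_rootsR/(_ x) := P0.
by rewrite inE /= rootZ // root_prod_XsubC xs.
Qed.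

Lemma poly_variation_add_le P : P != 0 ->
  (poly_variation false P + poly_variation true P + mup 0 P <= (size P).-1)%N.
Proof.
move=> P0; have := mup_geq 0 (mup 0 P) P0.
rewrite leqnn subr0 => /esym/dvdpP[Q PQ].
have Pl i : (i < mup 0 P)%N -> P`_i = 0.
  by move=> iv; rewrite PQ coefMXn iv.
have vn : (mup 0 P <= (size P).-1)%N.
  rewrite leqNgt; apply/negP => /Pl; rewrite -lead_coefE => /eqP.
  by rewrite lead_coef_eq0 (negPf P0).
have := variation_add_le (0 < lead_coef P) (0 < lead_coef P)
  ((size P).-1 - mup 0 P) Pl.
by rewrite eqxx addn0 -(leq_add2r (mup 0 P)) !subnK.
Qed.

(** Each signed count is at most its variation number, while both variation numbers and the
    multiplicity of 0 add up to at most the degree, the sum of all three counts. So equality holds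
    throughout, and [P] and [Q] share their variation numbers. *)
Lemma sign_counts_eq (sg : bool) b c s t
   (P : {poly R} := b *: \prod_(x <- s) ('X - x%:P))
   (Q : {poly R} := c *: \prod_(x <- t) ('X - x%:P)) : b != 0 -> c != 0 ->
  size s = size t ->
  (forall i, (P`_i == 0) = (Q`_i == 0)) ->
  (forall i, Q`_i != 0 -> (0 < P`_i) = (0 < Q`_i) (+) sg) ->
  [/\ count (< 0) s = count (< 0) t, count_mem 0 s = count_mem 0 t
    & count (> 0) s = count (> 0) t].
Proof.
move=> b0 c0 st zPQ sPQ.
have P0 : P != 0 by rewrite scaler_eq0 (negPf b0) monic_neq0 ?monic_prod_XsubC.
have Q0 : Q != 0 by rewrite scaler_eq0 (negPf c0) monic_neq0 ?monic_prod_XsubC.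
have sP : size P = (size s).+1 by rewrite size_scale // size_prod_XsubC.
have sQ : size Q = (size s).+1 by rewrite size_scale // size_prod_XsubC st.
have V d : poly_variation d P = poly_variation d Q.
  rewrite /poly_variation !lead_coefE sP sQ /= sPQ; last first.
    by have := Q0; rewrite -lead_coef_eq0 lead_coefE sQ.
  by apply: variation_sign => i _; [exact: zPQ | exact: sPQ].
have := poly_variation_add_le P0; have := poly_variation_add_le Q0.
rewrite -!V sP sQ !mup_scale_prod_XsubC //=.
have := count_le_poly_variation false s b0.
have := count_le_poly_variation true s b0.
have := count_le_poly_variation false t c0.
have := count_le_poly_variation true t c0.
rewrite -/P -/Q -!V.
have cE r : [/\
    count (fun x : R => (x != 0) && ((x < 0) == true)) r = count (< 0) r,
    count (fun x : R => (x != 0) && ((x < 0) == false)) r = count (> 0) r &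
    (count (< 0)%R r + count_mem 0%R r + count (> 0)%R r = size r)%N].
  split; try by apply: eq_count => x /=; case: ltgtP.
  by elim: r => //= x r; case: ltgtP => /=; lia.
have [-> -> +] := cE s; have [-> -> +] := cE t.
rewrite st; move: (count (< 0) s) (count_mem 0 s) (count (> 0) s).
move: (count (< 0) t) (count_mem 0 t) (count (> 0) t) (size t).
move: (poly_variation true P) (poly_variation false P) => *; split; lia.
Qed.

Lemma coef_prod_XsubC_gt0 s i : all (< 0) s -> (i <= size s)%N ->
  0 < (\prod_(x <- s) ('X - x%:P))`_i.
Proof.
elim: s i => [|x s IH] i /=.
  by case: i => // _ _; rewrite big_nil coef1.
case/andP=> x0 s0 si; rewrite big_cons mulrBl coefB coefXM coefCM.
have Hs j : 0 <= (\prod_(x <- s) ('X - x%:P))`_j.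
  have [js|js] := leqP j (size s); first exact/ltW/IH.
  by rewrite nth_default // size_prod_XsubC.
case: i si => [|i] si /=.
  by rewrite sub0r -mulNr mulr_gt0 ?oppr_gt0 ?IH.
rewrite -mulNr ltr_wpDr ?IH //.
by rewrite mulr_ge0 // oppr_ge0 ltW.
Qed.
End SignCounts.

(** * Real-rootedness and root signs of the composition *)

Section Composition.
Variable R : realType.
Implicit Types (P Q : {poly R}) (n : nat).

Lemma coef_schur_szego n P Q i :
  (schur_szego n P Q)`_i = P`_i * Q`_i / 'C(n, i)%:R.
Proof.
rewrite coef_poly ltnS; have [le_in|lt_ni] := leqP i n.
  have : 'C(n, i)%:R != 0 :> R by rewrite pnatr_eq0 -lt0n bin_gt0.
  by rewrite /bincoef => ?; field.
(* Beyond [n] the binomial is 0, and so is its inverse by convention. *)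
by rewrite bin_small // invr0 mulr0.
Qed.

Lemma Hyp_lead_coef_neq0 n P : Hyp n P -> lead_coef P != 0.
Proof. by move=> [sP _]; rewrite lead_coef_eq0 -size_poly_gt0 sP. Qed.

Lemma Hyp_coef_neq0 n P : Hyp n P -> P`_n != 0.
Proof.
by move=> hP; have := Hyp_lead_coef_neq0 hP; rewrite lead_coefE hP.1.
Qed.

(** The complex roots equal their real parts, so the complex factorization descends to the reals. *)
Lemma Hyp_split n P : Hyp n P ->
  exists s, size s = n /\ P = lead_coef P *: \prod_(x <- s) ('X - x%:P).
Proof.
move=> hP; have [sP rP] := hP; set f := real_complex R.
have [s Es] := closed_field_poly_normal (map_poly f P).
have l0 := Hyp_lead_coef_neq0 hP.
have lf : lead_coef (map_poly f P) != 0 by rewrite lead_coef_map fmorph_eq0.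
exists (map (@complex.Re R) s).
have sE : map f (map (@complex.Re R) s) = s.
  rewrite -map_comp map_id_in // => z zs; have /rP : root (map_poly f P) z.
    by rewrite Es rootZ // root_prod_XsubC.
  by case: z {zs} => x y /= ->.
split.
  have := congr1 (fun p : {poly R[i]} => size p) Es.
  by rewrite size_map_poly size_scale // size_prod_XsubC sP size_map => -[].
apply: (map_poly_inj f).
rewrite map_polyZ map_prod_XsubC {1}Es lead_coef_map.
by rewrite -[in LHS]sE !big_map.
Qed.

Lemma HypNeg_split n Q : HypNeg n Q -> exists s, [/\ size s = n,
  all (< 0) s & Q = lead_coef Q *: \prod_(x <- s) ('X - x%:P)].
Proof.
move=> [hQ nQ]; have [s [ss Es]] := Hyp_split hQ; exists s; split=> //.
apply/allP => x xs; apply: nQ; rewrite Es rootZ ?root_prod_XsubC //.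
exact: Hyp_lead_coef_neq0 hQ.
Qed.

Lemma Hyp_schur_szego n P Q :
  Hyp n P -> HypNeg n Q -> Hyp n (schur_szego n P Q).
Proof.
move=> hP hQ; set F := schur_szego n P Q; set f := real_complex R.
have [s [ss s0 Es]] := HypNeg_split hQ.
have lP := Hyp_coef_neq0 hP; have lQ := Hyp_coef_neq0 hQ.1.
split.
  apply/eqP; rewrite eqn_leq size_poly /= ltnNge.
  apply/negP => /leq_sizeP/(_ n (leqnn n))/eqP.
  by rewrite coef_schur_szego binn invr1 mulr1 mulf_eq0 (negPf lP) (negPf lQ).
have stF : stable (map_poly f F).
  move=> z z0; have stP : stable (map_poly f P).
    move=> w w0; apply/negP => /hP.2 wr.
    by move: w0; rewrite -complexIm wr ltxx.
  have := schur_szego_stable (s := map f s) (n := n) (z := z)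
    (P := map_poly f P).
  rewrite size_map size_map_poly hP.1 all_map => /(_ ss (leqnn _) stP).
  have -> : all (preim f (fun a : R[i] => a < 0)) s.
    by apply/allP => x /(allP s0) /= x0; rewrite ltcR.
  move=> /(_ isT z0) H.
  rewrite (@horner_coef_wide _ n.+1) ?size_map_poly ?size_poly //.
  have l0 : f (lead_coef Q) != 0.
    by rewrite fmorph_eq0 (Hyp_lead_coef_neq0 hQ.1).
  have := mulf_neq0 l0 H; rewrite mulr_sumr; congr (_ != _).
  apply: eq_bigr => i _.
  have EQ : Q`_i = lead_coef Q * (\prod_(x <- s) ('X - x%:P))`_i.
    by rewrite {1}Es coefZ.
  rewrite !coef_map coef_schur_szego /= EQ !rmorphM fmorphV rmorph_nat.
  have -> : \prod_(a <- [seq f i | i <- s]) ('X - a%:P) =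
     map_poly f (\prod_(x <- s) ('X - x%:P)).
    by rewrite map_prod_XsubC big_map.
  rewrite coef_map /=; ring.
move=> z rz; apply: complexI; rewrite complexIm.
have /orP[] : (0 <= 'Im z) || ('Im z <= 0) by rewrite -realE Creal_Im.
  rewrite le_eqVlt => /predU1P[<- //|/stF]; by rewrite -rootE rz.
rewrite le_eqVlt => /predU1P[-> //|z0].
(* The coefficients are real, so a zero in the lower half-plane would have its conjugate as a zero
   in the upper one. *)
have /stF : 0 < 'Im (z^*)%R by rewrite Im_conj oppr_gt0.
have Ff : map_poly Num.conj (map_poly f F) = map_poly f F.
  apply/polyP => i; rewrite !coef_map /= conj_Creal //.
  by apply/Creal_ImP; rewrite -complexIm.
by rewrite -Ff horner_map fmorph_eq0 -rootE rz.
Qed.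

Lemma schur_szego_counts n P Q s t : HypNeg n Q ->
  size s = n -> size t = n -> P != 0 -> schur_szego n P Q != 0 ->
  P = lead_coef P *: \prod_(x <- s) ('X - x%:P) ->
  schur_szego n P Q =
    lead_coef (schur_szego n P Q) *: \prod_(x <- t) ('X - x%:P) ->
  [/\ count (< 0) t = count (< 0) s, count_mem 0 t = count_mem 0 s
    & count (> 0) t = count (> 0) s].
Proof.
set F := schur_szego n P Q => hQ ss st P0 F0 EP EF.
have [r [sr r0 EQ]] := HypNeg_split hQ.
have lQ := Hyp_lead_coef_neq0 hQ.1.
have C0 i : (i <= n)%N -> 0 < 'C(n, i)%:R :> R by rewrite ltr0n bin_gt0.
have sP : size P = n.+1.
  by rewrite EP size_scale ?lead_coef_eq0 // size_prod_XsubC ss.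
have big i : (n < i)%N -> P`_i = 0 by move=> ni; rewrite nth_default // sP.
(* Coefficientwise, [F] is [P] times the positive [k i], up to the global sign of [lead_coef Q]. *)
pose k i := (\prod_(x <- r) ('X - x%:P))`_i / 'C(n, i)%:R.
have k0 i : (i <= n)%N -> 0 < k i.
  by move=> ni; rewrite divr_gt0 ?C0 // coef_prod_XsubC_gt0 // sr.
have FE i : F`_i = P`_i * k i * lead_coef Q.
  by rewrite coef_schur_szego EQ coefZ -EQ /k; ring.
apply: (@sign_counts_eq R (lead_coef Q < 0) (lead_coef F) (lead_coef P));
  rewrite -?EF -?EP ?lead_coef_eq0 ?ss //.
  move=> i; rewrite FE mulf_eq0 (negPf lQ) orbF mulf_eq0.
  have [ni|/big->] := leqP i n; last by rewrite eqxx.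
  by rewrite (gt_eqF (k0 _ ni)) orbF.
move=> i Pi; have ni : (i <= n)%N.
  by rewrite leqNgt; apply: contra Pi => /big->.
rewrite FE; case: (ltgtP (lead_coef Q) 0) lQ => // q0 _; rewrite ?addbT ?addbF.
  rewrite nmulr_lgt0 // pmulr_llt0 ?k0 //.
  by rewrite real_ltNge //= le_eqVlt eq_sym (negPf Pi).
by rewrite pmulr_lgt0 // pmulr_lgt0 ?k0.
Qed.
End Composition.

Theorem proposition5 (R : realType) (n : nat) (hn : (1 <= n)%N) :
  (forall u v w : nat, (u + v + w = n)%N ->
     forall P Q : {poly R}, Hsign n u v w P -> HypNeg n Q ->
       Hsign n u v w (schur_szego n P Q)) /\
  semigroup_on (@HypNeg R n) (@schur_szego R n).
Proof.
have Hyp0 (P : {poly R}) : Hyp n P -> P != 0.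
  by move=> [sP _]; rewrite -size_poly_gt0 sP.
split=> [u v w _ P Q [hP uP vP wP] hQ|].
  have hF := Hyp_schur_szego hP hQ.
  have [s [ss Es]] := Hyp_split hP; have [t [st Et]] := Hyp_split hF.
  have [un vn wn] := schur_szego_counts hQ ss st (Hyp0 _ hP) (Hyp0 _ hF) Es Et.
  have lP := Hyp_lead_coef_neq0 hP; have lF := Hyp_lead_coef_neq0 hF.
  move: uP vP wP; rewrite /num_neg_roots /num_pos_roots Es.
  rewrite !sum_mup_rootsR // mup_scale_prod_XsubC // -un -vn -wn => <- <- <-.
  rewrite -Es; split=> //; rewrite /num_neg_roots /num_pos_roots Et.
  - by rewrite sum_mup_rootsR.
  - by rewrite mup_scale_prod_XsubC.
  - by rewrite sum_mup_rootsR.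
split=> [P Q hP hQ|P Q S _ _ _]; last first.
  by apply/polyP => i; rewrite !coef_schur_szego; ring.
have hF := Hyp_schur_szego hP.1 hQ; split=> // x.
have [s [ss s0 Es]] := HypNeg_split hP; have [t [st Et]] := Hyp_split hF.
have [un _ _] := schur_szego_counts hQ ss st (Hyp0 _ hP.1) (Hyp0 _ hF) Es Et.
(* All [n] roots of [P] are negative, so the count makes all [n] entries of [t] negative. *)
have t0 : all (< 0) t by rewrite all_count un st -ss -all_count.
by rewrite Et rootZ ?lead_coef_eq0 ?Hyp0 // root_prod_XsubC => /(allP t0).
Qed.
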